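(* The Geometric polynomials $P_n$ satisfy the following. 1. If $m$ and $n$ are positive integers of different parity, then \[ \int_{-1}^0\left(\frac{P_{2j}(x)}{x}\right)^m\left(\frac{P_{2k}(x)}{x}\right)^n\,dx=0 \] for all positive integers $j\neq k$. 2. For all integers $j,k\ge1$, \[ \int_{-1}^0\frac{P_{2j}(x)}{x}\,\frac{P_{2k-1}(x)}{x}\,dx=0. \] 3. For every integer $n\ge2$, \[ \int_{-1}^0\frac{P_n(x)}{x}\,dx=0. \]
   Context: The Geometric polynomials $(P_n(z))_{n\ge0}$ are defined by the exponential generating function \[ \frac{1}{1-z(e^t-1)}=\sum_{n=0}^\infty P_n(z)\frac{t^n}{n!}. \] For $n\ge1$ one has $P_n(0)=0$, so $P_n(x)/x$ is a polynomial. *)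

(* Defs.v *)
From HB Require Import structures.
From mathcomp Require Import all_boot all_order all_algebra.
From mathcomp Require Import all_classical all_reals all_analysis.
From mathcomp Require Import zify.
Set Implicit Arguments.
Unset Strict Implicit.
Unset Printing Implicit Defensive.
Import Order.TTheory GRing.Theory Num.Theory.
Local Open Scope ring_scope.

(* Formal power series in t over A: [a n] is the coefficient of t^n.  The alias
   carries the Cauchy product, not the pointwise product of [nat -> A]. *)
Definition fps (A : Type) : Type := nat -> A.

Section Fps.
Variable A : comNzRingType.

HB.instance Definition _ := GRing.Zmodule.copy (fps A) (nat -> A).

Definition fps_const (c : A) : fps A := fun n => if n == 0%N then c else 0.

Definition fps_mul (a b : fps A) : fps A :=
  fun n => \sum_(i < n.+1) a i * b (n - i)%N.

Definition fps_trunc (N : nat) (a : fps A) : {poly A} := \poly_(i < N) a i.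

Lemma fps_mul_trunc (a b : fps A) (n N : nat) : (n < N)%N ->
  fps_mul a b n = (fps_trunc N a * fps_trunc N b)`_n.
Proof.
move=> nN; rewrite coefM; apply: eq_bigr => i _; rewrite !coef_poly.
by rewrite (leq_ltn_trans (leq_subr _ _) nN) (leq_ltn_trans (leq_ord i) nN).
Qed.

Lemma fps_mulA : associative fps_mul.
Proof.
move=> a b c; apply/funext => n.
transitivity ((fps_trunc n.+1 a * (fps_trunc n.+1 b * fps_trunc n.+1 c))`_n).
  rewrite coefM; apply: eq_bigr => i _; rewrite coef_poly ltn_ord.
  by rewrite (@fps_mul_trunc b c _ n.+1) // ltnS leq_subr.
rewrite mulrA coefM; apply: eq_bigr => i _.
by rewrite coef_poly ltnS leq_subr (@fps_mul_trunc a b _ n.+1).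
Qed.

Lemma fps_mulC : commutative fps_mul.
Proof.
by move=> a b; apply/funext => n; rewrite !(@fps_mul_trunc _ _ n n.+1) // mulrC.
Qed.

Lemma fps_mul_const (c : A) (a : fps A) n : fps_mul (fps_const c) a n = c * a n.
Proof.
rewrite /fps_mul big_ord_recl /= subn0 big1 ?addr0 // => i _.
by rewrite /fps_const /= mul0r.
Qed.

Lemma fps_mul1 : left_id (fps_const 1) fps_mul.
Proof. by move=> a; apply/funext => n; rewrite fps_mul_const mul1r. Qed.

Lemma fps_mulDl : left_distributive fps_mul +%R.
Proof.
move=> a b c; apply/funext => n.
by rewrite /fps_mul -[RHS]big_split; apply: eq_bigr => i _; apply: mulrDl.
Qed.

Lemma fps_1_neq0 : fps_const 1 != 0 :> fps A.
Proof.
apply/eqP => /(congr1 (fun f : fps A => f 0%N)).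
by move/eqP; rewrite /fps_const /= oner_eq0.
Qed.

HB.instance Definition _ := GRing.Zmodule_isComNzRing.Build (fps A)
  fps_mulA fps_mulC fps_mul1 fps_mulDl fps_1_neq0.

Definition fps_unit : pred (fps A) := fun a => `[< exists b : fps A, b * a = 1 >].

Definition fps_inv (a : fps A) : fps A :=
  match pselect (exists b : fps A, b * a = 1) with
  | left ex => sval (cid ex)
  | right _ => a
  end.

Lemma fps_mulVr : {in fps_unit, left_inverse 1 fps_inv *%R}.
Proof.
move=> a /asboolP ex; rewrite /fps_inv.
by case: pselect => // ex'; case: cid.
Qed.

Lemma fps_unitPl (a b : fps A) : b * a = 1 -> fps_unit a.
Proof. by move=> ba; apply/asboolP; exists b. Qed.

Lemma fps_inv_out : {in [predC fps_unit], fps_inv =1 id}.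
Proof.
move=> a; rewrite inE /= => /asboolP nex; rewrite /fps_inv.
by case: pselect.
Qed.

HB.instance Definition _ := GRing.ComNzRing_hasMulInverse.Build (fps A)
  fps_mulVr fps_unitPl fps_inv_out.

Lemma fps_coefM (a b : fps A) n : (a * b) n = \sum_(i < n.+1) a i * b (n - i)%N.
Proof. by []. Qed.

Lemma fps_coefD (a b : fps A) n : (a + b) n = a n + b n.
Proof. by []. Qed.

Lemma fps_coefN (a : fps A) n : (- a) n = - a n.
Proof. by []. Qed.

Lemma fps_coef1 n : (1 : fps A) n = if n == 0%N then 1 else 0.
Proof. by []. Qed.

Lemma fps_coefX_lt (u : fps A) : u 0%N = 0 ->
  forall k n, (n < k)%N -> (u ^+ k) n = 0.
Proof.
move=> u0; elim=> // k IH n nk; rewrite exprS fps_coefM big1 // => -[[|i] ? _] /=.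
  by rewrite u0 mul0r.
by rewrite IH ?mulr0 //; lia.
Qed.

Lemma fps_unit_1B (u : fps A) : u 0%N = 0 -> 1 - u \is a GRing.unit.
Proof.
move=> u0; pose v : fps A := fun n => (\sum_(k < n.+1) u ^+ k) n.
have vE n N : (n <= N)%N -> v n = (\sum_(k < N.+1) u ^+ k) n.
  move=> /subnK <-; elim: (N - n)%N => // d IH.
  rewrite addSn big_ord_recr [RHS]fps_coefD -IH fps_coefX_lt ?addr0 //.
  by rewrite ltnS leq_addl.
have uv : (1 - u) * v = 1.
  apply/funext => n.
  transitivity (((1 - u) * \sum_(k < n.+1) u ^+ k) n).
    by rewrite !fps_coefM; apply: eq_bigr => i _; rewrite (vE _ n) ?leq_subr.
  rewrite -opprB mulNr -subrX1 opprB fps_coefD fps_coefN.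
  by rewrite fps_coefX_lt ?subr0.
by apply/unitrPr; exists v.
Qed.

End Fps.

Section GeometricPolynomials.
Variable R : realType.

(* sum_n (p n) t^n / n! *)
Definition egf (p : nat -> {poly R}) : fps {poly R} :=
  fun n => (n`!%:R^-1 : R) *: p n.

Definition exp_t : fps {poly R} := egf (fun=> 1).

(* The variable z is ['X : {poly R}]. *)
Definition geometric_gf : fps {poly R} :=
  (1 - fps_const 'X * (exp_t - 1))^-1.

Definition geometric_poly (n : nat) : {poly R} := n`!%:R *: geometric_gf n.

(* P_n(z)/z as a polynomial; the division is exact for n >= 1, see
   [geometric_quotK]. *)
Definition geometric_quot (n : nat) : {poly R} := geometric_poly n %/ 'X.

Lemma geometric_gf_unit :
  1 - fps_const 'X * (exp_t - 1) \is a @GRing.unit (fps {poly R}).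
Proof.
apply: fps_unit_1B.
rewrite fps_coefM big_ord1 fps_coefD fps_coefN fps_coef1.
by rewrite /exp_t /egf /= fact0 invr1 scale1r subrr mulr0.
Qed.

Lemma egf_geometric_poly :
  egf geometric_poly = (1 - fps_const 'X * (exp_t - 1))^-1.
Proof.
by apply/funext => n; rewrite /egf /geometric_poly scalerA mulVf ?scale1r //.
Qed.

Lemma geometric_quotK n : (0 < n)%N ->
  geometric_quot n * 'X = geometric_poly n.
Proof.
move=> n0; rewrite divpK // /geometric_poly.
have -> : geometric_gf =
    1 + fps_const 'X * ((exp_t - 1) * geometric_gf).
  rewrite mulrA -[X in X + _](mulrV geometric_gf_unit) -/geometric_gf.
  by rewrite -mulrDl subrK mul1r.
rewrite fps_coefD fps_coef1 gtn_eqF // add0r.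
by rewrite [(fps_const _ * _) n]fps_mul_const scalerAr dvdp_mulIl.
Qed.

End GeometricPolynomials.

(* Main.v *)
(** The generating function F(z, t) satisfies dF/dt = z d((1 + z) F)/dz, so that
    Q_n := P_n(z)/z obeys Q_1 = 1 and Q_{n+1} = (z (1 + z) Q_n)' for n >= 1.
    As z (1 + z) is invariant under the reflection z -> -1 - z of [-1, 0], the
    recurrence gives Q_n(-1 - z) = (-1)^(n+1) Q_n(z); the first two integrands
    are thus antisymmetric.  The third integral is the difference of
    the values of z (1 + z) Q_{n-1} at 0 and -1, which both vanish. *)
Require Import Defs.
From mathcomp Require Import all_boot all_order all_algebra.
From mathcomp Require Import all_classical all_reals all_analysis.
From mathcomp Require Import ring lra zify.
Import Order.TTheory GRing.Theory Num.Theory.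
Import numFieldNormedType.Exports.
Local Open Scope classical_set_scope.
Local Open Scope ring_scope.

Section PolynomialIntegral.
Variable R : realType.
Implicit Types (p q : {poly R}) (a b : R).

Lemma integral_deriv p a b : a < b ->
  (\int[lebesgue_measure]_(x in [set` `[a, b]]) (p^`()).[x]%R%:E
    = (p.[b] - p.[a])%R%:E)%E.
Proof.
move=> ab; rewrite (@continuous_FTC2 _ _ (horner p)) ?EFinB //.
- by apply: continuous_subspaceT => x; exact: continuous_horner.
- split => [x _||]; first exact: derivable_horner.
    by apply: cvg_at_right_filter; exact: continuous_horner.
  by apply: cvg_at_left_filter; exact: continuous_horner.
- by move=> x _; rewrite -derivE.
Qed.

Lemma poly_antiderivative p : exists q, q^`() = p.
Proof.
exists (\poly_(i < (size p).+1) (p`_i.-1 / i%:R)).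
apply/polyP => i; rewrite coef_deriv coef_poly ltnS /=.
case: ltnP => [_|/(nth_default 0) ->]; last by rewrite mul0rn.
by rewrite -[LHS]mulr_natr divfK // pnatr_eq0.
Qed.

Lemma deriv_reflection : (- 1 - 'X : {poly R})^`() = - 1.
Proof. by rewrite derivB derivN derivC derivX oppr0 sub0r. Qed.

(** Passing to an antiderivative [q] replaces the change of variables in the Lebesgue integral by
    the chain rule for polynomials. *)
Lemma integral_antisymmetric p : p \Po (- 1 - 'X) = - p ->
  (\int[lebesgue_measure]_(x in [set` `[(-1)%R, 0%R : R]]) p.[x]%:E = 0)%E.
Proof.
move=> p_anti; have [q qE] := poly_antiderivative p.
have lt10 : -1 < 0 :> R by rewrite oppr_lt0.
(* The increment over [-1, 0] of [q - q \Po (- 1 - 'X)], whose derivative is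
   zero, is twice that of [q]. *)
have := integral_deriv (q - (q \Po (- 1 - 'X))) _ _ lt10.
rewrite derivB deriv_comp qE deriv_reflection p_anti mulrN1 opprK subrr.
under eq_integral do rewrite horner0.
rewrite integral0 => -[].
rewrite !hornerE !horner_comp !hornerE /= => incr.
rewrite -qE integral_deriv //; congr EFin.
move: incr; rewrite !subr0 opprK addNr => incr.
lra.
Qed.

End PolynomialIntegral.

Section FpsDerivations.
Variable A : comNzRingType.

Definition fps_deriv (a : fps A) : fps A := fun n => a n.+1 *+ n.+1.

(** Coefficient [n] of the derivative involves only coefficients up to [n.+1], so truncating both
    series below [n.+2] reduces this to the product rule for polynomials. *)
Lemma fps_derivM (a b : fps A) :
  fps_deriv (a * b) = fps_deriv a * b + a * fps_deriv b.
Proof.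
apply/funext => n; rewrite /fps_deriv [(a * b) _](@fps_mul_trunc _ a b _ n.+2)//.
rewrite -coef_deriv derivM coefD fps_coefD.
congr (_ + _); rewrite coefM fps_coefM; apply: eq_bigr => -[i /= lt_i] _;
  rewrite coef_deriv !coef_poly /fps_deriv !ltnS.
- by rewrite -ltnS lt_i (leq_trans (leq_subr _ _)).
- by rewrite ltnW // leq_subr.
Qed.

Lemma fps_derivB (a b : fps A) : fps_deriv (a - b) = fps_deriv a - fps_deriv b.
Proof. by apply/funext => n; apply: mulrnBl. Qed.

Lemma fps_deriv_const (c : A) : fps_deriv (fps_const c) = 0.
Proof. by apply/funext => n; apply: mul0rn. Qed.

(** This is d/dz on series in t with coefficients polynomial in z; [fps_deriv] is d/dt. *)
Definition coef_derivation (a : fps {poly A}) : fps {poly A} :=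
  fun n => (a n)^`().

Lemma coef_derivationM (a b : fps {poly A}) :
  coef_derivation (a * b) = coef_derivation a * b + a * coef_derivation b.
Proof.
apply/funext => n; rewrite /coef_derivation fps_coefD !fps_coefM raddf_sum -big_split.
by apply: eq_bigr => i _; rewrite /= derivM.
Qed.

Lemma coef_derivationB (a b : fps {poly A}) :
  coef_derivation (a - b) = coef_derivation a - coef_derivation b.
Proof. by apply/funext => n; apply: derivB. Qed.

Lemma coef_derivation_const (c : {poly A}) :
  coef_derivation (fps_const c) = fps_const c^`().
Proof.
by apply/funext => -[|n] //; rewrite /coef_derivation /fps_const /= deriv0.
Qed.

End FpsDerivations.

(** The derivative of an inverse: the second hypothesis is what any derivation makes of [f * g = 1],
    so both d/dt and d/dz are covered. *)
Lemma derivation_inv (A : comNzRingType) (f g df dg : A) :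
  f * g = 1 -> df * g + f * dg = 0 -> df = - (f * f * dg).
Proof.
move=> fg /eqP; rewrite addr_eq0 => /eqP dfg.
by rewrite -[LHS]mulr1 -fg mulrCA dfg mulrN mulrA.
Qed.

Section GeometricPolynomials.
Variable R : realType.
Local Notation X := (fps_const 'X : fps {poly R}).
Local Notation F := (geometric_gf R).
Local Notation E := (exp_t R).
Local Notation dt := (@fps_deriv _).
Local Notation dz := (@coef_derivation _).
Local Notation Q := (geometric_quot R).

Lemma dt_exp : dt E = E.
Proof.
apply/funext => n; rewrite /fps_deriv /exp_t /egf scalerMnl factS natrM invfM.
by rewrite -mulr_natl mulrA divff ?mul1r // pnatr_eq0.
Qed.

Lemma dz_exp : dz E = 0.
Proof.
by apply/funext => n; rewrite /coef_derivation /exp_t /egf derivZ derivC scaler0.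
Qed.

Lemma dt_1 : dt (1 : fps {poly R}) = 0. Proof. exact: fps_deriv_const. Qed.

Lemma dz_1 : dz (1 : fps {poly R}) = 0.
Proof.
rewrite [LHS]coef_derivation_const derivC.
by apply/funext => -[|n].
Qed.

Lemma dz_X : dz X = 1. Proof. by rewrite coef_derivation_const derivX. Qed.

(** Write [F] = 1/G. Then dF/dt = F^2 z e^t and dF/dz = F^2 (e^t - 1), and the claim reduces to G +
    (1 + z)(e^t - 1) = e^t. *)
Lemma geometric_gf_pde : dt F = X * (F + (1 + X) * dz F).
Proof.
have FG : F * (1 - X * (E - 1)) = 1 by apply/mulVr/geometric_gf_unit.
have [dtF dzF] : dt F = F * F * (X * E) /\ dz F = F * F * (E - 1).
  have dtG : dt (1 - X * (E - 1)) = - (X * E).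
    rewrite !(fps_derivB, fps_derivM) fps_deriv_const dt_exp dt_1; ring.
  have dzG : dz (1 - X * (E - 1)) = - (E - 1).
    rewrite !(coef_derivationB, coef_derivationM) dz_exp dz_1 dz_X; ring.
  have := congr1 dz FG; have := congr1 dt FG.
  rewrite fps_derivM coef_derivationM dt_1 dz_1.
  move=> /(derivation_inv _ _ _ _ _ FG) -> /(derivation_inv _ _ _ _ _ FG) ->.
  by rewrite dtG dzG !mulrN !opprK.
(* Expanding the undifferentiated [F] makes both sides multiples of [F * F], so that the remaining
   identity holds in the polynomial ring. *)
have FE : F = F * F * (1 - X * (E - 1)) by rewrite -mulrA FG mulr1.
rewrite dtF dzF [X in _ * (X + _)]FE; ring.
Qed.

(** The coefficient of t^n in the differential equation, scaled by n!. *)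
Lemma geometric_poly_rec n :
  geometric_poly R n.+1 = 'X * ((1 + 'X) * geometric_poly R n)^`().
Proof.
have rec : F n.+1 *+ n.+1 = 'X * ((1 + 'X) * F n)^`().
  transitivity (dt F n) => //; rewrite geometric_gf_pde [LHS]fps_mul_const.
  rewrite mulrDl mul1r !fps_coefD [(X * _) n]fps_mul_const /coef_derivation.
  by rewrite derivM derivD derivC derivX add0r mul1r mulrDl mul1r.
rewrite /geometric_poly factS natrM (mulrC n.+1%:R) -scalerA.
by rewrite -!scalerAr derivZ -scalerAr -rec (scaler_nat n.+1).
Qed.

Lemma geometric_quot1 : Q 1 = 1.
Proof.
have P0 : geometric_poly R 0 = 1.
  have /(congr1 (fun a : fps {poly R} => a 0%N)) :=
    mulVr (geometric_gf_unit R).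
  rewrite fps_coefM big_ord1 fps_coefD fps_coefN [(fps_const _ * _) _]fps_mul_const.
  rewrite fps_coefD fps_coefN /exp_t /egf fact0 invr1 scale1r fps_coef1 /=.
  by rewrite subrr mulr0 subr0 mulr1 /geometric_poly fact0 scale1r.
by rewrite /geometric_quot geometric_poly_rec P0 mulr1 derivD derivC derivX add0r
  mulr1 divpp // polyX_eq0.
Qed.

(** Exact division, available for [0 < n], puts [Q n * 'X] for the polynomial in the recurrence; one
    factor ['X] then cancels. *)
Lemma geometric_quot_rec n : (0 < n)%N ->
  Q n.+1 = ('X * (1 + 'X) * Q n)^`().
Proof.
move=> n_gt0; rewrite {1}/geometric_quot geometric_poly_rec -geometric_quotK //.
by rewrite mulKp ?polyX_eq0 //; congr deriv; ring.
Qed.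

Lemma geometric_quot_reflection n : (0 < n)%N ->
  Q n \Po (- 1 - 'X) = (-1) ^+ n.+1 * Q n.
Proof.
case: n => // n _; elim: n => [|n IHn].
  by rewrite geometric_quot1 -polyC1 comp_polyC mulr1 expr2 mulrNN mulr1.
have XX : 'X * (1 + 'X) \Po (- 1 - 'X) = 'X * (1 + 'X) :> {poly R}.
  rewrite comp_polyM comp_polyD comp_polyX -polyC1 comp_polyC; ring.
have := deriv_comp ('X * (1 + 'X) * Q n.+1) (- 1 - 'X).
rewrite -geometric_quot_rec // deriv_reflection comp_polyM XX IHn mulrN1.
(* The inner derivative -1 of the chain rule supplies the one extra sign per induction step. *)
move/(congr1 -%R); rewrite opprK => <-.
(* As a constant polynomial the sign can be pulled out of the derivative. *)
have -> : (-1) ^+ n.+2 = ((-1) ^+ n.+2)%:P :> {poly R}.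
  by rewrite rmorphXn /= polyCN.
rewrite mulrCA mul_polyC derivZ -geometric_quot_rec // -mul_polyC.
by rewrite [in RHS]exprS rmorphXn /= polyCN mulN1r mulNr.
Qed.

End GeometricPolynomials.

Theorem lemma2 (R : realType) :
  (forall m n : nat, (0 < m)%N -> (0 < n)%N -> odd m != odd n ->
     forall j k : nat, (0 < j)%N -> (0 < k)%N -> j != k ->
       (\int[lebesgue_measure]_(x in [set` `[(-1)%R, 0%R : R]])
          ((geometric_quot R (2 * j)).[x] ^+ m *
           (geometric_quot R (2 * k)).[x] ^+ n)%R%:E = 0)%E) /\
  (forall j k : nat, (1 <= j)%N -> (1 <= k)%N ->
     (\int[lebesgue_measure]_(x in [set` `[(-1)%R, 0%R : R]])
        ((geometric_quot R (2 * j)).[x] *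
         (geometric_quot R (2 * k - 1)).[x])%R%:E = 0)%E) /\
  (forall n : nat, (2 <= n)%N ->
     (\int[lebesgue_measure]_(x in [set` `[(-1)%R, 0%R : R]])
        (geometric_quot R n).[x]%R%:E = 0)%E).
Proof.
split; [|split].
- move=> m n _ _ mn j k j_gt0 k_gt0 _.
  under eq_integral do rewrite -!horner_exp -hornerM.
  apply: integral_antisymmetric.
  rewrite comp_polyM !rmorphXn /= !geometric_quot_reflection ?muln_gt0 //.
  (* At an even index the sign is -1, so the integrand picks up (-1)^(m + n), which is -1 by the
     parity hypothesis. *)
  rewrite !exprSr !mul2n -!muln2 !exprM !sqrr_sign.
  rewrite !mul1r !exprMn mulrACA -exprD -signr_odd oddD.
  by move: mn; case: (odd m); case: (odd n) => // _; rewrite mulN1r.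
- move=> j k j_gt0 k_gt0.
  under eq_integral do rewrite -hornerM.
  apply: integral_antisymmetric.
  rewrite comp_polyM !geometric_quot_reflection; try lia.
  rewrite mulrACA -exprD -signr_odd.
  (* Since [1 <= k], the truncated subtraction is exact and the second summand is [2 * k]. *)
  have -> : odd ((2 * j).+1 + (2 * k - 1).+1) by lia.
  by rewrite mulN1r.
- case=> [|[|n]] // _; rewrite geometric_quot_rec //.
  rewrite integral_deriv ?oppr_lt0 // !hornerE /=.
  (* The factor ['X] vanishes at 0 and the factor [1 + 'X] at -1. *)
  by rewrite !(subrr, mul0r, mulr0, oppr0).
Qed.
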